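(* The calculus $LS_{PASL}+IU$ is sound and cut-free complete with respect to the class of PASL Kripke relational frames with indivisible unit: for every formula $F$, (i) if $\emptyset;\emptyset\vdash w:F$ is derivable in $LS_{PASL}+IU$ (possibly with cut) for some label $w$, then $F$ is valid over this class of frames; and (ii) if $F$ is valid over this class, then $\emptyset;\emptyset\vdash w:F$ is derivable in $LS_{PASL}+IU$ without cut for some label variable $w$. Moreover, cut is admissible in $LS_{PASL}+IU$.
   Context: Formulae: $A ::= p \mid \top\mid\bot\mid\neg A\mid A\vee A\mid A\wedge A\mid A\to A\mid \top^*\mid A*A\mid A\mathrel{-\!\!*}A$, $p\in Var$. Semantics. A PASL Kripke relational frame is $(H,R,\epsilon)$, $H$ nonempty, $R\subseteq H^3$, $\epsilon\in H$, such that for all $h_i\in H$: $R(h_1,\epsilon,h_2)\iff h_1=h_2$; $R(h_1,h_2,h_3)\iff R(h_2,h_1,h_3)$; $R(h_1,h_5,h_4)\wedge R(h_2,h_3,h_5)\Rightarrow\exists h_6\,(R(h_6,h_3,h_4)\wedge R(h_1,h_2,h_6))$; (cancellativity) $R(h_1,h_2,h_3)\wedge R(h_1,h_4,h_3)\Rightarrow h_2=h_4$; (partial-determinism) $R(h_1,h_2,h_3)\wedge R(h_1,h_2,h_4)\Rightarrow h_3=h_4$. It has indivisible unit if $R(h_1,h_2,\epsilon)\Rightarrow h_1=\epsilon$ for all $h_1,h_2$. A model adds $\nu:Var\to\mathcal{P}(H)$; forcing: $h\Vdash p$ iff $h\in\nu(p)$; $\top$ always, $\bot$ never; $\neg,\wedge,\vee,\to$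 classical; $h\Vdash\top^*$ iff $h=\epsilon$; $h\Vdash A*B$ iff $\exists h_1,h_2$ with $R(h_1,h_2,h)$, $h_1\Vdash A$, $h_2\Vdash B$; $h\Vdash A\mathrel{-\!\!*}B$ iff $\forall h_1,h_2$, $R(h,h_1,h_2)$ and $h_1\Vdash A$ imply $h_2\Vdash B$. $F$ is valid over a class of frames iff forced at every world of every model on a frame in the class. Calculus. Labels: $LVar\cup\{\epsilon\}$. Labelled formula $a:A$; relational atom $(a,b\triangleright c)$; sequent $\mathcal{G};\Gamma\vdash\Delta$ with $\mathcal{G}$ a set of relational atoms and $\Gamma,\Delta$ multisets of labelled formulae; $[y/x]$ ($x$ label variable) uniform replacement; $\neg A:=A\to\bot$, $A\vee B:=\neg A\to B$. $LS_{PASL}$ rules (fresh = label variable not in conclusion): $id$: axiom $\mathcal{G};\Gamma,w:p\vdash w:p,\Delta$; $cut$: $\mathcal{G};\Gamma\vdash x:A,\Delta$ and $\mathcal{G}';\Gamma',x:A\vdash\Delta'\Rightarrow\mathcal{G},\mathcal{G}';\Gamma,\Gamma'\vdash\Delta,\Delta'$; $\bot L$: axiom $\mathcal{G};\Gamma,w:\bot\vdash\Delta$; $\top R$: axiom $\mathcal{G};\Gamma\vdash w:\top,\Delta$; $\top^*R$: axiom $\mathcal{G};\Gamma\vdash\epsilon:\top^*,\Delta$; $\top^*L$: $(\epsilon,w\triangleright\epsilon),\mathcal{G};\Gamma\vdash\Delta\Rightarrow\mathcal{G};\Gamma,w:\top^*\vdash\Delta$; $\wedge L$: $\mathcal{G};\Gamma,w:A,w:B\vdash\Delta\Rightarrow\mathcal{G};\Gamma,w:A\wedge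 B\vdash\Delta$; $\wedge R$: $\mathcal{G};\Gamma\vdash w:A,\Delta$ and $\mathcal{G};\Gamma\vdash w:B,\Delta\Rightarrow\mathcal{G};\Gamma\vdash w:A\wedge B,\Delta$; $\to L$: $\mathcal{G};\Gamma\vdash w:A,\Delta$ and $\mathcal{G};\Gamma,w:B\vdash\Delta\Rightarrow\mathcal{G};\Gamma,w:A\to B\vdash\Delta$; $\to R$: $\mathcal{G};\Gamma,w:A\vdash w:B,\Delta\Rightarrow\mathcal{G};\Gamma\vdash w:A\to B,\Delta$; $*L$: $(x,y\triangleright z),\mathcal{G};\Gamma,x:A,y:B\vdash\Delta\Rightarrow\mathcal{G};\Gamma,z:A*B\vdash\Delta$ ($x,y$ fresh); $\mathrel{-\!\!*}R$: $(x,z\triangleright y),\mathcal{G};\Gamma,x:A\vdash y:B,\Delta\Rightarrow\mathcal{G};\Gamma\vdash z:A\mathrel{-\!\!*}B,\Delta$ ($x,y$ fresh); $*R$: $(x,y\triangleright z),\mathcal{G};\Gamma\vdash x:A,z:A*B,\Delta$ and $(x,y\triangleright z),\mathcal{G};\Gamma\vdash y:B,z:A*B,\Delta\Rightarrow(x,y\triangleright z),\mathcal{G};\Gamma\vdash z:A*B,\Delta$; $\mathrel{-\!\!*}L$: $(x,y\triangleright z),\mathcal{G};\Gamma,y:A\mathrel{-\!\!*}B\vdash x:A,\Delta$ and $(x,y\triangleright z),\mathcal{G};\Gamma,y:A\mathrel{-\!\!*}B,z:B\vdash\Delta\Rightarrow(x,y\triangleright z),\mathcal{G};\Gamma,y:A\mathrel{-\!\!*}B\vdash\Delta$;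 $E$: $(y,x\triangleright z),(x,y\triangleright z),\mathcal{G};\Gamma\vdash\Delta\Rightarrow(x,y\triangleright z),\mathcal{G};\Gamma\vdash\Delta$; $A$: $(u,w\triangleright z),(y,v\triangleright w),(x,y\triangleright z),(u,v\triangleright x),\mathcal{G};\Gamma\vdash\Delta\Rightarrow(x,y\triangleright z),(u,v\triangleright x),\mathcal{G};\Gamma\vdash\Delta$ ($w$ fresh); $U$: $(x,\epsilon\triangleright x),\mathcal{G};\Gamma\vdash\Delta\Rightarrow\mathcal{G};\Gamma\vdash\Delta$; $A_C$: $(x,w\triangleright x),(y,y\triangleright w),(x,y\triangleright x),\mathcal{G};\Gamma\vdash\Delta\Rightarrow(x,y\triangleright x),\mathcal{G};\Gamma\vdash\Delta$ ($w$ fresh); $Eq_1$: $(\epsilon,w'\triangleright w'),\mathcal{G}[w'/w];\Gamma[w'/w]\vdash\Delta[w'/w]\Rightarrow(\epsilon,w\triangleright w'),\mathcal{G};\Gamma\vdash\Delta$; $Eq_2$: same premise $\Rightarrow(\epsilon,w'\triangleright w),\mathcal{G};\Gamma\vdash\Delta$; $P$: $(x,y\triangleright z),\mathcal{G}[z/w];\Gamma[z/w]\vdash\Delta[z/w]\Rightarrow(x,y\triangleright z),(x,y\triangleright w),\mathcal{G};\Gamma\vdash\Delta$; $C$: $(x,y\triangleright z),\mathcal{G}[y/w];\Gamma[y/w]\vdash\Delta[y/w]\Rightarrow(x,y\triangleright z),(x,w\triangleright z),\mathcal{G};\Gamma\vdash\Delta$ (in $Eq_1,Eq_2,P,C$,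 $w$ a label variable). $LS_{PASL}+IU$ adds $IU$: $(\epsilon,y\triangleright\epsilon),\mathcal{G}[\epsilon/x];\Gamma[\epsilon/x]\vdash\Delta[\epsilon/x]\Rightarrow(x,y\triangleright\epsilon),\mathcal{G};\Gamma\vdash\Delta$ ($x$ a label variable).
   Formalization: In (i), ''some label w'' is taken as ''some label variable w'': for w = ε the claim fails, since ε:⊤* is an axiom but ⊤* is not valid. The two fresh variables in *L and -*R are taken to be distinct. *)

(* Defs.v *)
From Stdlib Require Export List Permutation Arith.
From Stdlib Require Import Classical.
Export ListNotations.

Set Implicit Arguments.

(** * Formulae *)

Inductive formula (Var : Type) : Type :=
| Atom (p : Var)
| Top
| Bot
| And (A B : formula Var)
| Imp (A B : formula Var)
| Emp
| Star (A B : formula Var)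
| Wand (A B : formula Var).

Arguments Top {Var}.
Arguments Bot {Var}.
Arguments Emp {Var}.

(* Negation and disjunction are the abbreviations used by the calculus; lemmas
   [forces_Neg] and [forces_Or] below recover their forcing clauses. *)
Definition Neg (Var : Type) (A : formula Var) : formula Var := Imp A Bot.
Definition Or (Var : Type) (A B : formula Var) : formula Var := Imp (Neg A) B.

(** * Semantics *)

Record frame : Type := Frame {
  world :> Type;
  R : world -> world -> world -> Prop;
  emp : world;
  R_unit : forall h1 h2, R h1 emp h2 <-> h1 = h2;
  R_comm : forall h1 h2 h3, R h1 h2 h3 <-> R h2 h1 h3;
  R_assoc : forall h1 h2 h3 h4 h5,
    R h1 h5 h4 /\ R h2 h3 h5 -> exists h6, R h6 h3 h4 /\ R h1 h2 h6;
  R_cancel : forall h1 h2 h3 h4, R h1 h2 h3 /\ R h1 h4 h3 -> h2 = h4;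
  R_pdet : forall h1 h2 h3 h4, R h1 h2 h3 /\ R h1 h2 h4 -> h3 = h4
}.

Definition indivisible_unit (H : frame) : Prop :=
  forall h1 h2 : H, R H h1 h2 (emp H) -> h1 = emp H.

Fixpoint forces (Var : Type) (H : frame) (nu : Var -> H -> Prop) (h : H)
    (A : formula Var) : Prop :=
  match A with
  | Atom p => nu p h
  | Top => True
  | Bot => False
  | And A B => forces H nu h A /\ forces H nu h B
  | Imp A B => forces H nu h A -> forces H nu h B
  | Emp => h = emp H
  | Star A B => exists h1 h2,
      R H h1 h2 h /\ forces H nu h1 A /\ forces H nu h2 B
  | Wand A B => forall h1 h2,
      R H h h1 h2 -> forces H nu h1 A -> forces H nu h2 B
  end.

Definition valid_over (Var : Type) (K : frame -> Prop) (F : formula Var)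
    : Prop :=
  forall (H : frame), K H ->
  forall (nu : Var -> H -> Prop) (h : H), forces H nu h F.

Lemma forces_Neg (Var : Type) (H : frame) (nu : Var -> H -> Prop) (h : H)
    (A : formula Var) :
  forces H nu h (Neg A) <-> ~ forces H nu h A.
Proof. reflexivity. Qed.

Lemma forces_Or (Var : Type) (H : frame) (nu : Var -> H -> Prop) (h : H)
    (A B : formula Var) :
  forces H nu h (Or A B) <-> forces H nu h A \/ forces H nu h B.
Proof. simpl; destruct (classic (forces H nu h A)); tauto. Qed.

(** * Labelled sequents *)

(* Label variables are indexed by [nat]; [eps] is the label constant. *)
Inductive label : Type :=
| eps
| lvar (x : nat).

(* [(a, b, c)] stands for the relational atom (a, b |> c). *)
Definition ratom : Type := (label * label * label)%type.

Definition lformula (Var : Type) : Type := (label * formula Var)%type.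

Definition subst_label (y : label) (x : nat) (a : label) : label :=
  match a with
  | eps => eps
  | lvar z => if Nat.eqb z x then y else lvar z
  end.

(* [subst_ratoms y x G] is G[y/x], and likewise [subst_lformulae]. *)
Definition subst_ratoms (y : label) (x : nat) (G : list ratom) : list ratom :=
  map (fun r => match r with (a, b, c) =>
         (subst_label y x a, subst_label y x b, subst_label y x c) end) G.

Definition subst_lformulae (Var : Type) (y : label) (x : nat)
    (Gam : list (lformula Var)) : list (lformula Var) :=
  map (fun f => (subst_label y x (fst f), snd f)) Gam.

Definition labels_ratoms (G : list ratom) : list label :=
  flat_map (fun r => match r with (a, b, c) => [a; b; c] end) G.

Definition fresh (Var : Type) (x : nat) (G : list ratom)
    (Gam Del : list (lformula Var)) : Prop :=
  ~ In (lvar x) (labels_ratoms G ++ map fst Gam ++ map fst Del).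

Definition same_set (G G' : list ratom) : Prop := incl G G' /\ incl G' G.

(** * The calculus *)

(* [derivable c G Gam Del]: the sequent G; Gam |- Del has a derivation in
   LS_PASL + IU, in which cut may be used iff [c] is true.

   Sequents are represented by lists; rule [d_repr] identifies two
   representations of the same sequent, G being a finite set and Gam, Del being
   finite multisets.  As G is a set, the context of a rule may itself contain
   the principal atoms.  Two variables introduced by one rule are fresh and
   distinct (rules *L and -*R would be unsound otherwise). *)
Inductive derivable (Var : Type) (c : bool)
    : list ratom -> list (lformula Var) -> list (lformula Var) -> Prop :=
| d_repr G G' Gam Gam' Del Del' :
    same_set G G' -> Permutation Gam Gam' -> Permutation Del Del' ->
    derivable c G Gam Del ->
    derivable c G' Gam' Del'
| d_id G Gam Del w p :
    derivable c G ((w, Atom p) :: Gam) ((w, Atom p) :: Del)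
| d_cut G G' Gam Gam' Del Del' x A :
    c = true ->
    derivable c G Gam ((x, A) :: Del) ->
    derivable c G' ((x, A) :: Gam') Del' ->
    derivable c (G ++ G') (Gam ++ Gam') (Del ++ Del')
| d_BotL G Gam Del w :
    derivable c G ((w, Bot) :: Gam) Del
| d_TopR G Gam Del w :
    derivable c G Gam ((w, Top) :: Del)
| d_EmpR G Gam Del :
    derivable c G Gam ((eps, Emp) :: Del)
| d_EmpL G Gam Del w :
    derivable c ((eps, w, eps) :: G) Gam Del ->
    derivable c G ((w, Emp) :: Gam) Del
| d_AndL G Gam Del w A B :
    derivable c G ((w, A) :: (w, B) :: Gam) Del ->
    derivable c G ((w, And A B) :: Gam) Del
| d_AndR G Gam Del w A B :
    derivable c G Gam ((w, A) :: Del) ->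
    derivable c G Gam ((w, B) :: Del) ->
    derivable c G Gam ((w, And A B) :: Del)
| d_ImpL G Gam Del w A B :
    derivable c G Gam ((w, A) :: Del) ->
    derivable c G ((w, B) :: Gam) Del ->
    derivable c G ((w, Imp A B) :: Gam) Del
| d_ImpR G Gam Del w A B :
    derivable c G ((w, A) :: Gam) ((w, B) :: Del) ->
    derivable c G Gam ((w, Imp A B) :: Del)
| d_StarL G Gam Del x y z A B :
    x <> y ->
    fresh x G ((z, Star A B) :: Gam) Del ->
    fresh y G ((z, Star A B) :: Gam) Del ->
    derivable c ((lvar x, lvar y, z) :: G)
      ((lvar x, A) :: (lvar y, B) :: Gam) Del ->
    derivable c G ((z, Star A B) :: Gam) Del
| d_WandR G Gam Del x y z A B :
    x <> y ->
    fresh x G Gam ((z, Wand A B) :: Del) ->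
    fresh y G Gam ((z, Wand A B) :: Del) ->
    derivable c ((lvar x, z, lvar y) :: G)
      ((lvar x, A) :: Gam) ((lvar y, B) :: Del) ->
    derivable c G Gam ((z, Wand A B) :: Del)
| d_StarR G Gam Del x y z A B :
    derivable c ((x, y, z) :: G) Gam ((x, A) :: (z, Star A B) :: Del) ->
    derivable c ((x, y, z) :: G) Gam ((y, B) :: (z, Star A B) :: Del) ->
    derivable c ((x, y, z) :: G) Gam ((z, Star A B) :: Del)
| d_WandL G Gam Del x y z A B :
    derivable c ((x, y, z) :: G) ((y, Wand A B) :: Gam) ((x, A) :: Del) ->
    derivable c ((x, y, z) :: G) ((y, Wand A B) :: (z, B) :: Gam) Del ->
    derivable c ((x, y, z) :: G) ((y, Wand A B) :: Gam) Del
| d_E G Gam Del x y z :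
    derivable c ((y, x, z) :: (x, y, z) :: G) Gam Del ->
    derivable c ((x, y, z) :: G) Gam Del
| d_A G Gam Del x y z u v w :
    fresh w ((x, y, z) :: (u, v, x) :: G) Gam Del ->
    derivable c
      ((u, lvar w, z) :: (y, v, lvar w) :: (x, y, z) :: (u, v, x) :: G)
      Gam Del ->
    derivable c ((x, y, z) :: (u, v, x) :: G) Gam Del
| d_U G Gam Del x :
    derivable c ((x, eps, x) :: G) Gam Del ->
    derivable c G Gam Del
| d_AC G Gam Del x y w :
    fresh w ((x, y, x) :: G) Gam Del ->
    derivable c ((x, lvar w, x) :: (y, y, lvar w) :: (x, y, x) :: G) Gam Del ->
    derivable c ((x, y, x) :: G) Gam Del
| d_Eq1 G Gam Del w w' :
    derivable c ((eps, w', w') :: subst_ratoms w' w G)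
      (subst_lformulae w' w Gam) (subst_lformulae w' w Del) ->
    derivable c ((eps, lvar w, w') :: G) Gam Del
| d_Eq2 G Gam Del w w' :
    derivable c ((eps, w', w') :: subst_ratoms w' w G)
      (subst_lformulae w' w Gam) (subst_lformulae w' w Del) ->
    derivable c ((eps, w', lvar w) :: G) Gam Del
| d_P G Gam Del x y z w :
    derivable c ((x, y, z) :: subst_ratoms z w G)
      (subst_lformulae z w Gam) (subst_lformulae z w Del) ->
    derivable c ((x, y, z) :: (x, y, lvar w) :: G) Gam Del
| d_C G Gam Del x y z w :
    derivable c ((x, y, z) :: subst_ratoms y w G)
      (subst_lformulae y w Gam) (subst_lformulae y w Del) ->
    derivable c ((x, y, z) :: (x, lvar w, z) :: G) Gam Del
| d_IU G Gam Del x y :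
    derivable c ((eps, y, eps) :: subst_ratoms eps x G)
      (subst_lformulae eps x Gam) (subst_lformulae eps x Del) ->
    derivable c ((lvar x, y, eps) :: G) Gam Del.

(* Main.v *)
(** Soundness is an induction on derivations, and cut admissibility follows from
    it by cut-free completeness for arbitrary sequents. For completeness, call a
    sequent robust if every sequent that refines one of its substitution
    instances is cut-free derivable; here refining means that each formula is
    still present or has already been decomposed. Robustness absorbs weakening,
    contraction and the label substitutions of Eq1, Eq2, P, C and IU, so none of
    these needs a separate admissibility proof, and an atom (eps, a |> b) can be
    read as an equation between labels instead of being substituted away. A
    sequent that is not robust extends by rounds to a saturated one, whose labels
    modulo these equations form a countermodel. *)

Require Import Defs.
From Stdlib Require Import Classical ClassicalEpsilon FunctionalExtensionality.
From Stdlib Require Import PropExtensionality ProofIrrelevance Lia.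

Set Implicit Arguments.

(** The obstacle is that Eq1, Eq2, P, C and IU rename labels and most logical rules consume their
    principal formula, so the sequents along a branch read upwards do not increase and have no union
    to serve as a limit. Tracking failure of robustness avoids this. A sequent that is not robust
    has some underivable refinement, but this refinement is never fixed and may be a different one
    after each step; the visible sequent only grows by inclusion and keeps all its labels. Each
    extension is justified by contraposition: given any refinement of the current sequent, one rule
    applied to that refinement yields premises that refine the extended sequent, so robustness of
    the extensions returns to the sequent itself. *)

Definition sat_ratoms (H : frame) (rho : label -> H) (G : list ratom) : Prop :=
  forall a b c, In (a, b, c) G -> R H (rho a) (rho b) (rho c).

Definition refutes (Var : Type) (H : frame) (nu : Var -> H -> Prop)
    (rho : label -> H) (G : list ratom) (Gam Del : list (lformula Var)) : Prop :=
  rho eps = emp H /\ sat_ratoms H rho G /\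
  (forall w A, In (w, A) Gam -> forces H nu (rho w) A) /\
  (forall w A, In (w, A) Del -> ~ forces H nu (rho w) A).

Definition upd (T : Type) (rho : label -> T) (x : nat) (v : T) (a : label) : T :=
  match a with
  | eps => rho eps
  | lvar z => if Nat.eqb z x then v else rho (lvar z)
  end.

Lemma upd_same (T : Type) (rho : label -> T) x v : upd rho x v (lvar x) = v.
Proof. simpl. now rewrite Nat.eqb_refl. Qed.

Lemma upd_other (T : Type) (rho : label -> T) x v a :
  a <> lvar x -> upd rho x v a = rho a.
Proof.
  destruct a as [|z]; simpl; trivial.
  intros n. destruct (Nat.eqb_spec z x); trivial. now subst.
Qed.

Definition labels (Var : Type) (G : list ratom) (Gam Del : list (lformula Var)) :=
  labels_ratoms G ++ map fst Gam ++ map fst Del.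

Lemma in_labels_ratoms G a b c : In (a, b, c) G ->
  In a (labels_ratoms G) /\ In b (labels_ratoms G) /\ In c (labels_ratoms G).
Proof.
  intros i. unfold labels_ratoms.
  repeat split; apply in_flat_map; exists (a, b, c); simpl; tauto.
Qed.

Lemma in_labels_fst (Var : Type) (Gam : list (lformula Var)) w A :
  In (w, A) Gam -> In w (map fst Gam).
Proof. intros i. now apply (in_map fst) in i. Qed.

Lemma in_subst_ratoms y x G a b c : In (a, b, c) G ->
  In (subst_label y x a, subst_label y x b, subst_label y x c) (subst_ratoms y x G).
Proof.
  intros i. unfold subst_ratoms. apply in_map_iff. now exists (a, b, c).
Qed.

Lemma in_subst_ratoms_inv y x G r : In r (subst_ratoms y x G) ->
  exists a b c, In (a, b, c) G /\
    r = (subst_label y x a, subst_label y x b, subst_label y x c).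
Proof.
  unfold subst_ratoms. rewrite in_map_iff.
  intros [[[a b] c] [e i]]. now exists a, b, c.
Qed.

Lemma in_subst_lformulae (Var : Type) y x (Gam : list (lformula Var)) w A :
  In (w, A) Gam -> In (subst_label y x w, A) (subst_lformulae y x Gam).
Proof.
  intros i. unfold subst_lformulae. apply in_map_iff. now exists (w, A).
Qed.

Lemma in_subst_lformulae_inv (Var : Type) y x (Gam : list (lformula Var)) w A :
  In (w, A) (subst_lformulae y x Gam) ->
  exists w', In (w', A) Gam /\ w = subst_label y x w'.
Proof.
  unfold subst_lformulae. rewrite in_map_iff.
  intros [[w' A'] [e i]]. simpl in e. injection e as <- <-. now exists w'.
Qed.

Lemma val_subst_label (T : Type) (rho : label -> T) y x :
  rho y = rho (lvar x) -> forall a, rho (subst_label y x a) = rho a.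
Proof.
  intros e [|z]; simpl; trivial.
  destruct (Nat.eqb_spec z x); congruence.
Qed.

(* [repeat split] would also unfold [refutes]. *)
Ltac split_conj := repeat match goal with |- _ /\ _ => split end.

(** * Soundness over frames with indivisible unit *)

Section Soundness.
Variables (Var : Type) (H : frame) (nu : Var -> H -> Prop).

Lemma refutes_upd rho G Gam Del x v :
  fresh x G Gam Del -> refutes H nu rho G Gam Del ->
  refutes H nu (upd rho x v) G Gam Del.
Proof.
  intros f (e & g & l & r).
  assert (n : forall a, In a (labels G Gam Del) -> upd rho x v a = rho a).
  { intros a i. apply upd_other. intros ->. now apply f. }
  unfold labels in n. split; [exact e|]. split; [|split].
  - intros a b c i. destruct (in_labels_ratoms _ _ _ _ i) as (?&?&?).
    rewrite !n by (rewrite !in_app_iff; tauto). now apply g.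
  - intros w A i. pose proof (in_labels_fst _ _ _ i).
    rewrite n by (rewrite !in_app_iff; tauto). now apply l.
  - intros w A i. pose proof (in_labels_fst _ _ _ i).
    rewrite n by (rewrite !in_app_iff; tauto). now apply r.
Qed.

(** A valuation that gives two labels the same world cannot tell a sequent from the instance
    identifying them. This serves all five substitution rules. *)
Lemma refutes_subst rho G Gam Del y x :
  rho y = rho (lvar x) -> refutes H nu rho G Gam Del ->
  refutes H nu rho (subst_ratoms y x G) (subst_lformulae y x Gam)
    (subst_lformulae y x Del).
Proof.
  intros e (e0 & g & l & r). pose proof (val_subst_label rho y x e) as v.
  split; [exact e0|]. split; [|split].
  - intros a b c i. destruct (in_subst_ratoms_inv _ _ _ _ i) as (a'&b'&c'&i'&E).
    injection E as -> -> ->. rewrite !v. now apply g.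
  - intros w A i. destruct (in_subst_lformulae_inv _ _ _ _ _ i) as (w'&i'&->).
    rewrite v. now apply l.
  - intros w A i. destruct (in_subst_lformulae_inv _ _ _ _ _ i) as (w'&i'&->).
    rewrite v. now apply r.
Qed.

Lemma refutes_ratom rho G Gam Del a b c :
  refutes H nu rho ((a, b, c) :: G) Gam Del <->
  R H (rho a) (rho b) (rho c) /\ refutes H nu rho G Gam Del.
Proof.
  unfold refutes, sat_ratoms. split.
  - intros (e & g & l & r). simpl in *. intuition.
  - intros (k & e & g & l & r). simpl. intuition. now injection H1 as <- <- <-.
Qed.

Lemma refutes_ant rho G Gam Del w A :
  refutes H nu rho G ((w, A) :: Gam) Del <->
  forces H nu (rho w) A /\ refutes H nu rho G Gam Del.
Proof.
  unfold refutes. split.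
  - intros (e & g & l & r). simpl in *. intuition.
  - intros (k & e & g & l & r). simpl. intuition. now injection H1 as <- <-.
Qed.

Lemma refutes_suc rho G Gam Del w A :
  refutes H nu rho G Gam ((w, A) :: Del) <->
  ~ forces H nu (rho w) A /\ refutes H nu rho G Gam Del.
Proof.
  unfold refutes. split.
  - intros (e & g & l & r). simpl in *. repeat split; eauto.
  - intros (k & e & g & l & r). simpl. repeat split; auto.
    intros w' A' [E | i]; [injection E as <- <- | ]; eauto.
Qed.

(** Refutation depends on membership only, so this covers both the change of representation in
    [d_repr] and the splitting of contexts by cut. *)
Lemma refutes_incl rho G Gam Del G' Gam' Del' :
  incl G' G -> incl Gam' Gam -> incl Del' Del ->
  refutes H nu rho G Gam Del -> refutes H nu rho G' Gam' Del'.
Proof.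
  intros i1 i2 i3 (e & g & l & r). repeat split; auto.
  intros a b c i. now apply g, i1.
Qed.

Lemma R_unit_l (h1 h2 : H) : R H (emp H) h1 h2 <-> h1 = h2.
Proof. rewrite R_comm. apply R_unit. Qed.

Lemma fresh_neq x G (Gam Del : list (lformula Var)) a :
  fresh x G Gam Del -> In a (labels G Gam Del) -> a <> lvar x.
Proof. intros f i ->. now apply f. Qed.

Hypothesis IU : indivisible_unit H.

Theorem soundness c G Gam Del : derivable c G Gam Del ->
  forall rho, ~ refutes H nu rho G Gam Del.
Proof.
  induction 1 as
    [G G' Gam Gam' Del Del' sG sGam sDel _ IH
    |G Gam Del w p
    |G G' Gam Gam' Del Del' x A _ _ IH1 _ IH2
    |G Gam Del w
    |G Gam Del w
    |G Gam Del
    |G Gam Del w _ IH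
    |G Gam Del w A B _ IH
    |G Gam Del w A B _ IH1 _ IH2
    |G Gam Del w A B _ IH1 _ IH2
    |G Gam Del w A B _ IH
    |G Gam Del x y z A B xy fx fy _ IH
    |G Gam Del x y z A B xy fx fy _ IH
    |G Gam Del x y z A B _ IH1 _ IH2
    |G Gam Del x y z A B _ IH1 _ IH2
    |G Gam Del x y z _ IH
    |G Gam Del x y z u v w fw _ IH
    |G Gam Del x _ IH
    |G Gam Del x y w fw _ IH
    |G Gam Del w w' _ IH
    |G Gam Del w w' _ IH
    |G Gam Del x y z w _ IH
    |G Gam Del x y z w _ IH
    |G Gam Del x y _ IH]; intros rho ref;
    pose proof (proj1 ref) as re.
  - apply (IH rho). revert ref. apply refutes_incl; [apply sG| |].
    + intros f. apply Permutation_in, sGam.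
    + intros f. apply Permutation_in, sDel.
  - rewrite refutes_ant, refutes_suc in ref. tauto.
  - destruct (classic (forces H nu (rho x) A)).
    + apply (IH2 rho). rewrite refutes_ant. split; trivial.
      revert ref; apply refutes_incl; auto using incl_appr, incl_refl.
    + apply (IH1 rho). rewrite refutes_suc. split; trivial.
      revert ref; apply refutes_incl; auto using incl_appl, incl_refl.
  - now rewrite refutes_ant in ref.
  - rewrite refutes_suc in ref. simpl in ref. tauto.
  - rewrite refutes_suc in ref. simpl in ref. tauto.
  - apply (IH rho). rewrite refutes_ant in ref. rewrite refutes_ratom, re.
    simpl in ref. rewrite R_unit_l. tauto.
  - apply (IH rho). rewrite !refutes_ant in *. simpl in ref. tauto.
  - rewrite refutes_suc in ref. simpl in ref.
    destruct (classic (forces H nu (rho w) A));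
      [apply (IH2 rho) | apply (IH1 rho)]; rewrite refutes_suc; tauto.
  - rewrite refutes_ant in ref. simpl in ref.
    destruct (classic (forces H nu (rho w) A));
      [apply (IH2 rho) | apply (IH1 rho)]; rewrite ?refutes_suc, ?refutes_ant; tauto.
  - apply (IH rho). rewrite refutes_suc in ref. simpl in ref.
    rewrite refutes_ant, refutes_suc. tauto.
  - pose proof ref as ref'. rewrite refutes_ant in ref'.
    destruct ref' as [(h1 & h2 & r & f1 & f2) _].
    set (rho' := upd (upd rho x h1) y h2).
    assert (iz : In z (labels G ((z, Star A B) :: Gam) Del)).
    { unfold labels. rewrite !in_app_iff. simpl. tauto. }
    assert (ez : rho' z = rho z).
    { unfold rho'. rewrite !upd_other; eauto using fresh_neq. }
    assert (ex : rho' (lvar x) = h1).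
    { unfold rho'. rewrite upd_other, upd_same; congruence. }
    assert (ey : rho' (lvar y) = h2) by apply upd_same.
    apply (IH rho'). rewrite refutes_ratom, !refutes_ant, ex, ey, ez.
    split_conj; trivial.
    apply (refutes_upd h1 fx) in ref. apply (refutes_upd h2 fy) in ref.
    rewrite refutes_ant in ref. apply ref.
  - pose proof ref as ref'. rewrite refutes_suc in ref'.
    destruct ref' as [nf _].
    assert (ex : exists h1 h2, R H (rho z) h1 h2 /\ forces H nu h1 A /\
                   ~ forces H nu h2 B).
    { apply NNPP. intros n. apply nf. intros h1 h2 r f.
      apply NNPP. intros k. apply n. eauto. }
    destruct ex as (h1 & h2 & r & f1 & f2).
    set (rho' := upd (upd rho x h1) y h2).
    assert (iz : In z (labels G Gam ((z, Wand A B) :: Del))).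
    { unfold labels. rewrite !in_app_iff. simpl. tauto. }
    assert (ez : rho' z = rho z).
    { unfold rho'. rewrite !upd_other; eauto using fresh_neq. }
    assert (ex : rho' (lvar x) = h1).
    { unfold rho'. rewrite upd_other, upd_same; congruence. }
    assert (ey : rho' (lvar y) = h2) by apply upd_same.
    apply (IH rho'). rewrite refutes_ratom, refutes_ant, refutes_suc, ex, ey, ez.
    split_conj; trivial; [now apply R_comm|].
    apply (refutes_upd h1 fx) in ref. apply (refutes_upd h2 fy) in ref.
    rewrite refutes_suc in ref. apply ref.
  - destruct (classic (forces H nu (rho x) A)) as [f1 | f1];
      [apply (IH2 rho) | apply (IH1 rho)]; rewrite refutes_suc; split; trivial.
    intros f2. rewrite refutes_ratom, refutes_suc in ref.
    destruct ref as (r & nf & _). apply nf. now exists (rho x), (rho y).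
  - destruct (classic (forces H nu (rho x) A)) as [f1 | f1].
    + apply (IH2 rho). rewrite refutes_ratom, !refutes_ant in *.
      destruct ref as (r & f & k). split_conj; trivial.
      apply (f (rho x)); trivial. now apply R_comm.
    + apply (IH1 rho). now rewrite refutes_suc.
  - apply (IH rho). rewrite refutes_ratom. split; trivial.
    rewrite refutes_ratom in ref. now apply R_comm.
  - pose proof ref as ref'. rewrite !refutes_ratom in ref'.
    destruct ref' as (r1 & r2 & _).
    assert (ex : exists h, R H (rho u) h (rho z) /\ R H (rho y) (rho v) h).
    (* The frame axiom nests on the right while rule A nests on the left, hence the commutations
       before and after its use. *)
    { destruct (R_assoc H (rho y) (rho v) (rho u) (rho z) (rho x)) as (h & k1 & k2).
      - split; apply R_comm; trivial.
      - exists h. split; trivial. now apply R_comm. }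
    destruct ex as (h & k1 & k2).
    assert (n : forall a, In a [x; y; z; u; v] -> upd rho w h a = rho a).
    { intros a i. apply upd_other. eapply fresh_neq; [exact fw|].
      unfold labels, labels_ratoms. simpl in *. intuition. }
    apply (IH (upd rho w h)). rewrite 2!refutes_ratom, upd_same.
    rewrite !n by (simpl; tauto). split_conj; trivial.
    now apply refutes_upd.
  - apply (IH rho). rewrite refutes_ratom, re. split; trivial. now apply R_unit.
  - pose proof ref as ref'. rewrite !refutes_ratom in ref'.
    destruct ref' as (r1 & _).
    assert (ex : exists h, R H (rho x) h (rho x) /\ R H (rho y) (rho y) h).
    (* Rule A_C is the case of associativity where both principal atoms are (x, y |> x), that is, u
       = x and v = y. *)
    { destruct (R_assoc H (rho y) (rho y) (rho x) (rho x) (rho x)) as (h & k1 & k2).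
      - split; apply R_comm; trivial.
      - exists h. split; trivial. now apply R_comm. }
    destruct ex as (h & k1 & k2).
    assert (n : forall a, In a [x; y] -> upd rho w h a = rho a).
    { intros a i. apply upd_other. eapply fresh_neq; [exact fw|].
      unfold labels, labels_ratoms. simpl in *. intuition. }
    apply (IH (upd rho w h)). rewrite 2!refutes_ratom, upd_same.
    rewrite !n by (simpl; tauto). split_conj; trivial.
    now apply refutes_upd.
  - rewrite refutes_ratom, re, R_unit_l in ref. destruct ref as [e ref].
    apply (IH rho). rewrite refutes_ratom, re, R_unit_l. split; trivial.
    now apply refutes_subst.
  - rewrite refutes_ratom, re, R_unit_l in ref. destruct ref as [e ref].
    apply (IH rho). rewrite refutes_ratom, re, R_unit_l. split; trivial.
    now apply refutes_subst.
  - rewrite !refutes_ratom in ref. destruct ref as (r1 & r2 & ref).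
    apply (IH rho). rewrite refutes_ratom. split; trivial.
    apply refutes_subst; trivial. eapply R_pdet; eauto.
  - rewrite !refutes_ratom in ref. destruct ref as (r1 & r2 & ref).
    apply (IH rho). rewrite refutes_ratom. split; trivial.
    apply refutes_subst; trivial. eapply R_cancel; eauto.
  - rewrite !refutes_ratom, re in ref. destruct ref as (r1 & ref).
    pose proof (IU _ _ r1) as e.
    apply (IH rho). rewrite refutes_ratom, re. split; [congruence|].
    apply refutes_subst; congruence.
Qed.
End Soundness.

Lemma derivable_same_set (Var : Type) c G G' (Gam Del : list (lformula Var)) :
  same_set G G' -> derivable c G Gam Del -> derivable c G' Gam Del.
Proof.
  intros e. exact (d_repr e (Permutation_refl _) (Permutation_refl _)).
Qed.

(* [side s true] is the antecedent and [side s false] the succedent. *)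
Record sequent (Var : Type) : Type := Seq {
  rel : list ratom;
  side : bool -> list (lformula Var)
}.

(** * Refinement of sequents along label maps *)

Section Covering.
Variable Var : Type.
Implicit Types (s t : sequent Var) (A B : formula Var).

Definition provable s := derivable false (rel s) (side s true) (side s false).

(* [w : A] is on side [b] of [s], or has been consumed there by logical rules
   read upwards. Star on the right and Wand on the left are kept by their rules. *)
Fixpoint cov s b A (w : label) : Prop :=
  In (w, A) (side s b) \/
  match A with
  | And A B => if b then cov s true A w /\ cov s true B w
               else cov s false A w \/ cov s false B w
  | Imp A B => if b then cov s false A w \/ cov s true B w
               else cov s true A w /\ cov s false B w
  | Emp => if b then In (eps, w, eps) (rel s) else False
  | Star A B => if b then exists x y, In (x, y, w) (rel s) /\
                                      cov s true A x /\ cov s true B y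
                else False
  | Wand A B => if b then False
                else exists x y, In (x, w, y) (rel s) /\
                                 cov s true A x /\ cov s false B y
  | _ => False
  end.

(** The map [f] stands for the accumulated label substitutions, but any map fixing [eps] is allowed,
    which lets fresh labels be sent anywhere. Atoms must be literally present because no rule loses
    them except by substitution; formulae need only be covered, since rules consume them. *)
Definition covers (f : label -> label) s t : Prop :=
  f eps = eps /\
  (forall a b c, In (a, b, c) (rel s) -> In (f a, f b, f c) (rel t)) /\
  (forall b w A, In (w, A) (side s b) -> cov t b A (f w)).

Lemma cov_in s b A w : In (w, A) (side s b) -> cov s b A w.
Proof. intros i. destruct A; now left. Qed.

(** Needed for [covers] to compose: a formula decomposed in [s] may have components that are
    decomposed further in [t]. The case of [Emp] is where [f eps = eps] enters. *)
Lemma covers_cov f s t : covers f s t ->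
  forall A b w, cov s b A w -> cov t b A (f w).
Proof.
  intros (e & g & l). induction A; intros b w [i | i]; eauto;
    try contradiction; destruct b; try contradiction; right.
  - destruct i; split; auto.
  - destruct i; auto.
  - destruct i; auto.
  - destruct i; split; auto.
  - rewrite <- e. auto.
  - destruct i as (x & y & i1 & i2 & i3). exists (f x), (f y). auto.
  - destruct i as (x & y & i1 & i2 & i3). exists (f x), (f y). auto.
Qed.

Lemma covers_trans f g s t u :
  covers f s t -> covers g t u -> covers (fun a => g (f a)) s u.
Proof.
  intros (e & h & l) c. pose proof (covers_cov c) as cc.
  destruct c as (e' & h' & l'). split; [congruence|]. split; auto.
Qed.

Definition add_rel (r : ratom) s := Seq (r :: rel s) (side s).
Definition add_at b (f : lformula Var) s :=
  Seq (rel s) (fun b' => if Bool.eqb b b' then f :: side s b' else side s b').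

Lemma covers_add_rel f s t a b c : covers f s t ->
  In (f a, f b, f c) (rel t) -> covers f (add_rel (a, b, c) s) t.
Proof.
  intros (e & g & l) i. split; [exact e|]. split; [|exact l].
  intros a' b' c' [E | k]; auto. now injection E as <- <- <-.
Qed.

Lemma covers_add_at f s t b w A : covers f s t ->
  cov t b A (f w) -> covers f (add_at b (w, A) s) t.
Proof.
  intros (e & g & l) i. split; [exact e|]. split; [exact g|].
  intros b' w' A' k. simpl in k. destruct (Bool.eqb_spec b b') as [<-|]; auto.
  destruct k as [E | k]; auto. now injection E as <- <-.
Qed.

Lemma covers_incl s t : incl (rel s) (rel t) ->
  (forall b, incl (side s b) (side t b)) -> covers (fun a => a) s t.
Proof.
  intros i1 i2. repeat split; auto. intros b w A k. now apply cov_in, i2.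
Qed.

Lemma provable_repr s G Gam Del :
  derivable false G Gam Del -> same_set G (rel s) ->
  Permutation Gam (side s true) -> Permutation Del (side s false) ->
  provable s.
Proof. intros d g p q. now apply (d_repr g p q). Qed.

(* Every rule is applied with its principal atoms duplicated into the context, so
   that P, C and the other substitution rules also act on a copy of them. *)
Lemma same_set_cons r G : In r G -> same_set (r :: G) G.
Proof. intros i. split; intros k; simpl; intuition. now subst. Qed.

Lemma same_set_cons2 r r' G : In r G -> In r' G -> same_set (r :: r' :: G) G.
Proof. intros i i'. split; intros k; simpl; intuition; now subst. Qed.

(** A rule consumes one occurrence, whereas [cov] sees membership only. Here [s0] is [s] without
    that occurrence (others may remain), and the last clause says that a premise built over [s0]
    still refines [s] once it covers the principal formula again. *)
Lemma extract s b w A : In (w, A) (side s b) -> exists s0,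
  (provable (add_at b (w, A) s0) -> provable s) /\
  rel s0 = rel s /\
  forall t, incl (rel s) (rel t) ->
    (forall b', incl (side s0 b') (side t b')) ->
    cov t b A w -> covers (fun a => a) s t.
Proof.
  intros i. destruct (in_split _ _ i) as (l1 & l2 & e).
  exists (Seq (rel s) (fun b' => if Bool.eqb b b' then l1 ++ l2 else side s b')).
  split; [|split; trivial].
  - intros d. refine (provable_repr s d _ _ _); [now split | |];
      destruct b; simpl in *; trivial; rewrite e; apply Permutation_middle.
  - intros t i1 i2 c. split; trivial. split; [auto|].
    intros b' w' A' k. pose proof (i2 b') as i2b. simpl in i2b. clear i2.
    destruct (Bool.eqb_spec b b') as [<-|].
    + rewrite e in k. apply in_app_iff in k. simpl in k.
      assert (k' : (w, A) = (w', A') \/ In (w', A') (l1 ++ l2)).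
      { rewrite in_app_iff. tauto. }
      destruct k' as [E | k']; [now injection E as <- <-|].
      now apply cov_in, i2b.
    + now apply cov_in, i2b.
Qed.

(** A threshold instead of a single fresh variable, because *L and -*R need two distinct ones. *)
Lemma exists_fresh_above (L : list label) :
  exists n, forall x, n <= x -> ~ In (lvar x) L.
Proof.
  induction L as [|[|z] L [n IH]].
  - exists 0. auto.
  - exists n. intros x i [k | k]; [discriminate | now apply (IH x)].
  - exists (n + S z). intros x i [k | k]; [injection k; lia | apply (IH x); trivial; lia].
Qed.

Definition labs s := labels (rel s) (side s true) (side s false).

Lemma labs_rel s a b c : In (a, b, c) (rel s) ->
  In a (labs s) /\ In b (labs s) /\ In c (labs s).
Proof.
  intros i. destruct (in_labels_ratoms _ _ _ _ i) as (?&?&?).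
  unfold labs, labels. rewrite !in_app_iff. tauto.
Qed.

Lemma labs_side s b w A : In (w, A) (side s b) -> In w (labs s).
Proof.
  intros i. apply in_labels_fst in i. unfold labs, labels.
  rewrite !in_app_iff. destruct b; tauto.
Qed.

Lemma covers_upd f s t x v :
  covers f s t -> ~ In (lvar x) (labs s) -> covers (upd f x v) s t.
Proof.
  intros (e & g & l) n.
  assert (u : forall a, In a (labs s) -> upd f x v a = f a).
  { intros a i. apply upd_other. now intros ->. }
  split; [exact e|]. split.
  - intros a b c i. destruct (labs_rel _ _ _ _ i) as (?&?&?).
    rewrite !u by trivial. now apply g.
  - intros b w A i. rewrite u by (eapply labs_side; eauto). now apply l.
Qed.

(** * Rules read upwards modulo covering *)

Notation below s t := (covers (fun a => a) s t).

Ltac extr i :=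
  let s0 := fresh "s0" in
  destruct (extract _ _ _ _ i) as (s0 & prov & erel & cv);
  apply prov; clear prov; unfold provable; simpl.

(** Pattern of all the logical step lemmas: if the formula is still present, the rule is applied and
    its premises are handed to the continuation; if it has been consumed, its components are already
    covered and [s] itself is handed over. *)
Lemma step_AndL s w A B : cov s true (And A B) w ->
  (forall t, below s t -> cov t true A w -> cov t true B w -> provable t) ->
  provable s.
Proof.
  intros [i | [c1 c2]] k; [|apply k; auto using covers_incl, incl_refl].
  extr i. apply d_AndL.
  apply (k (add_at true (w, A) (add_at true (w, B) s0))).
  - apply cv; simpl; [rewrite erel; apply incl_refl | |].
    + intros []; simpl; auto using incl_tl, incl_refl.
    + right. split; apply cov_in; simpl; auto.
  - apply cov_in; simpl; auto.
  - apply cov_in; simpl; auto.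
Qed.

Lemma step_AndR s w A B : cov s false (And A B) w ->
  (forall t, below s t -> cov t false A w \/ cov t false B w -> provable t) ->
  provable s.
Proof.
  intros [i | c] k; [|apply k; auto using covers_incl, incl_refl].
  extr i. apply d_AndR.
  - apply (k (add_at false (w, A) s0)); [|left; apply cov_in; simpl; auto].
    apply cv; simpl; [rewrite erel; apply incl_refl | |].
    + intros []; simpl; auto using incl_tl, incl_refl.
    + right. left. apply cov_in; simpl; auto.
  - apply (k (add_at false (w, B) s0)); [|right; apply cov_in; simpl; auto].
    apply cv; simpl; [rewrite erel; apply incl_refl | |].
    + intros []; simpl; auto using incl_tl, incl_refl.
    + right. right. apply cov_in; simpl; auto.
Qed.

Lemma step_ImpL s w A B : cov s true (Imp A B) w ->
  (forall t, below s t -> cov t false A w \/ cov t true B w -> provable t) ->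
  provable s.
Proof.
  intros [i | c] k; [|apply k; auto using covers_incl, incl_refl].
  extr i. apply d_ImpL.
  - apply (k (add_at false (w, A) s0)); [|left; apply cov_in; simpl; auto].
    apply cv; simpl; [rewrite erel; apply incl_refl | |].
    + intros []; simpl; auto using incl_tl, incl_refl.
    + right. left. apply cov_in; simpl; auto.
  - apply (k (add_at true (w, B) s0)); [|right; apply cov_in; simpl; auto].
    apply cv; simpl; [rewrite erel; apply incl_refl | |].
    + intros []; simpl; auto using incl_tl, incl_refl.
    + right. right. apply cov_in; simpl; auto.
Qed.

Lemma step_ImpR s w A B : cov s false (Imp A B) w ->
  (forall t, below s t -> cov t true A w -> cov t false B w -> provable t) ->
  provable s.
Proof.
  intros [i | [c1 c2]] k; [|apply k; auto using covers_incl, incl_refl].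
  extr i. apply d_ImpR.
  apply (k (add_at true (w, A) (add_at false (w, B) s0))).
  - apply cv; simpl; [rewrite erel; apply incl_refl | |].
    + intros []; simpl; auto using incl_tl, incl_refl.
    + right. split; apply cov_in; simpl; auto.
  - apply cov_in; simpl; auto.
  - apply cov_in; simpl; auto.
Qed.

Lemma step_EmpL s w : cov s true Emp w ->
  (forall t, below s t -> In (eps, w, eps) (rel t) -> provable t) ->
  provable s.
Proof.
  intros [i | c] k; [|apply k; auto using covers_incl, incl_refl].
  extr i. apply d_EmpL.
  apply (k (add_rel (eps, w, eps) s0)); [|simpl; auto].
  apply cv; simpl; auto using incl_refl.
  rewrite erel; auto using incl_tl, incl_refl.
Qed.

Lemma step_StarL s z A B : cov s true (Star A B) z ->
  (forall t x y, below s t -> In (x, y, z) (rel t) ->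
     cov t true A x -> cov t true B y -> provable t) ->
  provable s.
Proof.
  intros [i | (x & y & c1 & c2 & c3)] k;
    [|apply (k _ x y); auto using covers_incl, incl_refl].
  extr i.
  destruct (exists_fresh_above (labs (add_at true (z, Star A B) s0))) as [n fr].
  apply d_StarL with (x := n) (y := S n); [lia | apply fr; lia | apply fr; lia |].
  apply (k (add_rel (lvar n, lvar (S n), z)
             (add_at true (lvar n, A) (add_at true (lvar (S n), B) s0)))
           (lvar n) (lvar (S n))).
  - apply cv; simpl; [rewrite erel; auto using incl_tl, incl_refl | |].
    + intros []; simpl; auto using incl_tl, incl_refl.
    + right. exists (lvar n), (lvar (S n)).
      split; [simpl; auto|]. split; apply cov_in; simpl; auto.
  - simpl; auto.
  - apply cov_in; simpl; auto.
  - apply cov_in; simpl; auto.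
Qed.

Lemma step_WandR s z A B : cov s false (Wand A B) z ->
  (forall t x y, below s t -> In (x, z, y) (rel t) ->
     cov t true A x -> cov t false B y -> provable t) ->
  provable s.
Proof.
  intros [i | (x & y & c1 & c2 & c3)] k;
    [|apply (k _ x y); auto using covers_incl, incl_refl].
  extr i.
  destruct (exists_fresh_above (labs (add_at false (z, Wand A B) s0))) as [n fr].
  apply d_WandR with (x := n) (y := S n); [lia | apply fr; lia | apply fr; lia |].
  apply (k (add_rel (lvar n, z, lvar (S n))
             (add_at true (lvar n, A) (add_at false (lvar (S n), B) s0)))
           (lvar n) (lvar (S n))).
  - apply cv; simpl; [rewrite erel; auto using incl_tl, incl_refl | |].
    + intros []; simpl; auto using incl_tl, incl_refl.
    + right. exists (lvar n), (lvar (S n)).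
      split; [simpl; auto|]. split; apply cov_in; simpl; auto.
  - simpl; auto.
  - apply cov_in; simpl; auto.
  - apply cov_in; simpl; auto.
Qed.

(** Since *R keeps its principal formula, [cov] on this side is plain membership. The premises
    contain the formula again, so they refine [s]. *)
Lemma step_StarR s x y z A B : cov s false (Star A B) z -> In (x, y, z) (rel s) ->
  (forall t, below s t -> cov t false A x \/ cov t false B y -> provable t) ->
  provable s.
Proof.
  intros [i | []] g k.
  extr i. rewrite erel.
  refine (derivable_same_set (same_set_cons _ _ g) _).
  apply d_StarR.
  - apply (k (add_rel (x, y, z) (Seq (rel s)
             (side (add_at false (x, A) (add_at false (z, Star A B) s0))))));
      [|left; apply cov_in; simpl; auto].
    apply cv; simpl; auto using incl_tl, incl_refl.
    intros []; simpl; auto using incl_tl, incl_refl.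
  - apply (k (add_rel (x, y, z) (Seq (rel s)
             (side (add_at false (y, B) (add_at false (z, Star A B) s0))))));
      [|right; apply cov_in; simpl; auto].
    apply cv; simpl; auto using incl_tl, incl_refl.
    intros []; simpl; auto using incl_tl, incl_refl.
Qed.

Lemma step_WandL s x y z A B : cov s true (Wand A B) y -> In (x, y, z) (rel s) ->
  (forall t, below s t -> cov t false A x \/ cov t true B z -> provable t) ->
  provable s.
Proof.
  intros [i | []] g k.
  extr i. rewrite erel.
  refine (derivable_same_set (same_set_cons _ _ g) _).
  apply d_WandL.
  - apply (k (add_rel (x, y, z) (Seq (rel s)
             (side (add_at false (x, A) (add_at true (y, Wand A B) s0))))));
      [|left; apply cov_in; simpl; auto].
    apply cv; simpl; auto using incl_tl, incl_refl.
    intros []; simpl; auto using incl_tl, incl_refl.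
  - apply (k (add_rel (x, y, z) (Seq (rel s)
             (side (add_at true (y, Wand A B) (add_at true (z, B) s0))))));
      [|right; apply cov_in; simpl; auto].
    apply cv; simpl; auto using incl_tl, incl_refl.
    intros []; simpl; auto using incl_tl, incl_refl.
Qed.

Lemma below_add_rel s r : below s (add_rel r s).
Proof. apply covers_incl; simpl; auto using incl_tl, incl_refl. Qed.

Lemma step_U s a : (forall t, below s t -> In (a, eps, a) (rel t) -> provable t) ->
  provable s.
Proof.
  intros k. apply d_U with (x := a).
  apply (k (add_rel (a, eps, a) s)); simpl; auto using below_add_rel.
Qed.

Lemma step_E s x y z : In (x, y, z) (rel s) ->
  (forall t, below s t -> In (y, x, z) (rel t) -> provable t) ->
  provable s.
Proof.
  intros g k.
  refine (derivable_same_set (same_set_cons _ _ g) _).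
  apply d_E.
  apply (k (add_rel (y, x, z) (add_rel (x, y, z) s))); [|simpl; auto].
  apply covers_incl; simpl; auto using incl_tl, incl_refl.
Qed.

Lemma step_A s x y z u v : In (x, y, z) (rel s) -> In (u, v, x) (rel s) ->
  (forall t w, below s t -> In (u, w, z) (rel t) -> In (y, v, w) (rel t) ->
     provable t) ->
  provable s.
Proof.
  intros g1 g2 k.
  refine (derivable_same_set (same_set_cons2 _ _ _ g1 g2) _).
  destruct (exists_fresh_above (labs (add_rel (x, y, z) (add_rel (u, v, x) s))))
    as [n fr].
  apply d_A with (w := n); [apply fr; lia|].
  apply (k (add_rel (u, lvar n, z) (add_rel (y, v, lvar n)
             (add_rel (x, y, z) (add_rel (u, v, x) s)))) (lvar n)); simpl; auto.
  apply covers_incl; simpl; auto using incl_tl, incl_refl.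
Qed.

Definition subst_sequent (y : label) (x : nat) s : sequent Var :=
  Seq (subst_ratoms y x (rel s)) (fun b => subst_lformulae y x (side s b)).

(** This is why a premise of a substitution rule counts as a refinement of its conclusion. *)
Lemma covers_subst y x s r :
  covers (subst_label y x) s (add_rel r (subst_sequent y x s)).
Proof.
  split; [reflexivity|]. split.
  - intros a b c i. right. now apply in_subst_ratoms.
  - intros b w A i. apply cov_in. now apply in_subst_lformulae.
Qed.

Lemma subst_label_same y x : subst_label y x (lvar x) = y.
Proof. simpl. now rewrite Nat.eqb_refl. Qed.

Lemma subst_label_idem y x : subst_label y x y = y.
Proof. destruct y as [|z]; simpl; trivial. now destruct (Nat.eqb z x). Qed.

Lemma covers_id s : below s s.
Proof. apply covers_incl; auto using incl_refl. Qed.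

(** The calculus replaces variables only, so the direction of the replacement depends on which side
    is [eps]. The continuation learns just that the two labels become equal, and the direction is
    forgotten. The same device is used for P and C, where the two atoms may be swapped. *)
Lemma step_Eq s a b : In (eps, a, b) (rel s) ->
  (forall f t, covers f s t -> f a = f b -> provable t) -> provable s.
Proof.
  intros g k.
  destruct a as [|w]; [destruct b as [|w]|].
  - apply (k (fun a => a)); auto using covers_id.
  - refine (derivable_same_set (same_set_cons _ _ g) _).
    apply d_Eq2. apply (k _ _ (covers_subst eps w s (eps, eps, eps))).
    now rewrite subst_label_same.
  - refine (derivable_same_set (same_set_cons _ _ g) _).
    apply d_Eq1. apply (k _ _ (covers_subst b w s (eps, b, b))).
    now rewrite subst_label_same, subst_label_idem.
Qed.

Lemma step_P s x y z w : In (x, y, z) (rel s) -> In (x, y, w) (rel s) ->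
  (forall f t, covers f s t -> f z = f w -> provable t) -> provable s.
Proof.
  intros g1 g2 k.
  destruct w as [|w]; [destruct z as [|w]|].
  - apply (k (fun a => a)); auto using covers_id.
  - refine (derivable_same_set (same_set_cons2 _ _ _ g2 g1) _).
    apply d_P. apply (k _ _ (covers_subst eps w s (x, y, eps))).
    now rewrite subst_label_same.
  - refine (derivable_same_set (same_set_cons2 _ _ _ g1 g2) _).
    apply d_P. apply (k _ _ (covers_subst z w s (x, y, z))).
    now rewrite subst_label_same, subst_label_idem.
Qed.

Lemma step_C s x y z w : In (x, y, z) (rel s) -> In (x, w, z) (rel s) ->
  (forall f t, covers f s t -> f y = f w -> provable t) -> provable s.
Proof.
  intros g1 g2 k.
  destruct w as [|w]; [destruct y as [|w]|].
  - apply (k (fun a => a)); auto using covers_id.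
  - refine (derivable_same_set (same_set_cons2 _ _ _ g2 g1) _).
    apply d_C. apply (k _ _ (covers_subst eps w s (x, eps, z))).
    now rewrite subst_label_same.
  - refine (derivable_same_set (same_set_cons2 _ _ _ g1 g2) _).
    apply d_C. apply (k _ _ (covers_subst y w s (x, y, z))).
    now rewrite subst_label_same, subst_label_idem.
Qed.

Lemma step_IU s x y : In (x, y, eps) (rel s) ->
  (forall f t, covers f s t -> f x = eps -> provable t) -> provable s.
Proof.
  intros g k. destruct x as [|w].
  - apply (k (fun a => a)); auto using covers_id.
  - refine (derivable_same_set (same_set_cons _ _ g) _).
    apply d_IU. apply (k _ _ (covers_subst eps w s (eps, y, eps))).
    apply subst_label_same.
Qed.

Lemma provable_id s w p :
  cov s true (Atom p) w -> cov s false (Atom p) w -> provable s.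
Proof.
  intros [i | []] [j | []].
  destruct (in_split _ _ i) as (l1 & l2 & e), (in_split _ _ j) as (l1' & l2' & e').
  refine (provable_repr s (d_id false (rel s) (l1 ++ l2) (l1' ++ l2') w p) _ _ _).
  - now split.
  - rewrite e. apply Permutation_middle.
  - rewrite e'. apply Permutation_middle.
Qed.

Lemma provable_BotL s w : cov s true Bot w -> provable s.
Proof. intros [i | []]. extr i. apply d_BotL. Qed.

Lemma provable_TopR s w : cov s false Top w -> provable s.
Proof. intros [i | []]. extr i. apply d_TopR. Qed.

Lemma provable_EmpR s : cov s false Emp eps -> provable s.
Proof. intros [i | []]. extr i. apply d_EmpR. Qed.
End Covering.

(** * Saturation *)

Section Saturation.
Variable Var : Type.
Implicit Types (s t : sequent Var) (A B : formula Var).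

Definition robust s := forall f t, covers f s t -> provable t.

Definition ext s t := incl (rel s) (rel t) /\ forall b, incl (side s b) (side t b).

Lemma ext_refl s : ext s s.
Proof. split; auto using incl_refl. Qed.

Lemma ext_trans s t u : ext s t -> ext t u -> ext s u.
Proof.
  intros [i j] [i' j']. split; [|intros b]; eauto using incl_tran.
Qed.

Lemma ext_add_rel s r : ext s (add_rel r s).
Proof. split; simpl; auto using incl_tl, incl_refl. Qed.

Lemma ext_add_at s b f : ext s (add_at b f s).
Proof.
  split; simpl; [apply incl_refl|]. intros b'.
  destruct (Bool.eqb b b'); auto using incl_tl, incl_refl.
Qed.

Lemma in_add_at s b w A : In (w, A) (side (add_at b (w, A) s) b).
Proof. simpl. rewrite Bool.eqb_reflx. now left. Qed.

Lemma in_add_at_l s b b' f w A :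
  In (w, A) (side s b') -> In (w, A) (side (add_at b f s) b').
Proof. intros i. now apply ext_add_at. Qed.

Definition persistent (Q : sequent Var -> Prop) :=
  forall t u, ext t u -> Q t -> Q u.

(** Quantifying over all extensions of [s] lets one requirement be forced after another, and
    persistence keeps the earlier ones true meanwhile. *)
Definition forceable s (Q : sequent Var -> Prop) :=
  persistent Q /\
  forall t, ext s t -> ~ robust t -> exists u, ext t u /\ ~ robust u /\ Q u.

(** The contrapositive form, in which the step lemmas can be applied to an arbitrary refinement of
    [t]. *)
Lemma forceable_intro s Q : persistent Q ->
  (forall t, ext s t -> (forall u, ext t u -> Q u -> robust u) -> robust t) ->
  forceable s Q.
Proof.
  intros p k. split; [exact p|]. intros t e n. apply NNPP. intros m.
  apply n, k; trivial. intros u e' q. apply NNPP. intros n'. apply m. eauto.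
Qed.

Lemma forceable_and s P Q : forceable s P -> forceable s Q ->
  forceable s (fun t => P t /\ Q t).
Proof.
  intros [p k] [p' k']. split.
  - intros t u e [a b]. split; [apply (p t) | apply (p' t)]; trivial.
  - intros t e n. destruct (k t e n) as (u & e' & n' & q).
    destruct (k' u (ext_trans e e') n') as (v & e'' & n'' & q').
    exists v. split; [exact (ext_trans e' e'')|]. split; trivial.
    split; trivial. now apply (p u).
Qed.

Lemma forceable_True s : forceable s (fun _ => True).
Proof.
  split; [intros ?; trivial|]. intros t e n. exists t. auto using ext_refl.
Qed.

Lemma forceable_imp s (P : Prop) Q : (P -> forceable s Q) ->
  forceable s (fun t => P -> Q t).
Proof.
  intros k. destruct (classic P) as [p | np].
  - destruct (k p) as [q k']. split.
    + intros t u e a _. eauto.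
    + intros t e n. destruct (k' t e n) as (u & ?). exists u. tauto.
  - split; [intros t u e a b; contradiction|].
    intros t e n. exists t. split; [apply ext_refl | tauto].
Qed.

Lemma forceable_list s (T : Type) (l : list T) (Q : T -> sequent Var -> Prop) :
  (forall x, In x l -> forceable s (Q x)) ->
  forceable s (fun t => forall x, In x l -> Q x t).
Proof.
  induction l as [|y l IH]; intros k.
  - split; [intros ? ? ? ? ? []|]. intros t e n. exists t.
    repeat split; auto using ext_refl, incl_refl. intros ? [].
  - destruct (forceable_and (k y (or_introl eq_refl))
                (IH (fun x i => k x (or_intror i)))) as [p q].
    split.
    + intros t u e a x i. apply (proj1 (k x i) t u e). auto.
    + intros t e n. destruct (q t e n) as (u & e' & n' & a & b).
      exists u. repeat (split; [assumption|]). intros x [<- | i]; auto.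
Qed.

(** Hintikka conditions for a single formula. They use literal membership instead of [cov], because
    the growing sequents never consume anything. *)
Definition demand (b : bool) A (w : label) t : Prop :=
  match A with
  | And A B => if b then In (w, A) (side t true) /\ In (w, B) (side t true)
               else In (w, A) (side t false) \/ In (w, B) (side t false)
  | Imp A B => if b then In (w, A) (side t false) \/ In (w, B) (side t true)
               else In (w, A) (side t true) /\ In (w, B) (side t false)
  | Emp => if b then In (eps, w, eps) (rel t) else True
  | Star A B => if b then exists x y, In (x, y, w) (rel t) /\
                       In (x, A) (side t true) /\ In (y, B) (side t true)
                else True
  | Wand A B => if b then True
                else exists x y, In (x, w, y) (rel t) /\
                       In (x, A) (side t true) /\ In (y, B) (side t false)
  | _ => True
  end.

Lemma persistent_demand b A w : persistent (demand b A w).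
Proof.
  intros t u [i j] d. destruct A, b; simpl in *; trivial; unfold incl in *;
    try (destruct d as (x & y & d); exists x, y); intuition.
Qed.

Lemma covers_in f s t b w A :
  covers f s t -> In (w, A) (side s b) -> cov t b A (f w).
Proof. intros c. apply c. Qed.

Lemma covers_below f s t u :
  covers f s t -> covers (fun a => a) t u -> covers f s u.
Proof. intros c d. exact (covers_trans c d). Qed.


(** In a refinement [u] of [t] the formula is covered, so a step lemma leads to sequents [v] below
    [u] in which its components are covered. Then [v] also refines [t] extended by these components,
    and that extension is robust by [K]. *)
Lemma forceable_demand s b A w : In (w, A) (side s b) ->
  forceable s (demand b A w).
Proof.
  intros i. apply forceable_intro; [apply persistent_demand|].
  intros t e K f u C. apply e in i. pose proof (covers_in _ _ _ C i) as c.
  assert (fr := exists_fresh_above (labs t)). destruct fr as [n fr].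
  pose proof (fr n (le_n n)) as fr0. pose proof (fr (S n) (le_S _ _ (le_n n))) as fr1.
  pose proof (labs_side _ _ _ _ i) as iw.
  (* For *L and -*R the extension of [t] names the components by [n] and [S n]. Being new to [t],
     these can be sent to whatever labels [x] and [y] the decomposition in [v] happens to use. *)
  assert (nm : forall v x y, covers (fun a => a) u v ->
    let g := upd (upd f n x) (S n) y in
    covers g t v /\ g (lvar n) = x /\ g (lvar (S n)) = y /\ g w = f w).
  { intros v x y bl g. split; [|split; [|split]].
    - apply covers_upd, fr1. apply covers_upd, fr0. now apply (covers_below C).
    - unfold g. rewrite upd_other, upd_same; trivial. intros E. injection E. lia.
    - apply upd_same.
    - unfold g. rewrite !upd_other; trivial; now intros ->. }
  (* Where the demand is [True], [t] itself is the required extension. *)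
  destruct A, b; try (refine (K t (ext_refl t) I f u C)).
  - apply (step_AndL c). intros v bl c1 c2.
    refine (K (add_at true (w, A1) (add_at true (w, A2) t)) _ _ f v _).
    + eauto using ext_trans, ext_add_at.
    + split; auto using in_add_at, in_add_at_l.
    + eauto using covers_add_at, covers_below.
  - apply (step_AndR c). intros v bl [c1 | c1].
    + refine (K (add_at false (w, A1) t) (ext_add_at _ _ _) _ f v _).
      * left. apply in_add_at.
      * eauto using covers_add_at, covers_below.
    + refine (K (add_at false (w, A2) t) (ext_add_at _ _ _) _ f v _).
      * right. apply in_add_at.
      * eauto using covers_add_at, covers_below.
  - apply (step_ImpL c). intros v bl [c1 | c1].
    + refine (K (add_at false (w, A1) t) (ext_add_at _ _ _) _ f v _).
      * left. apply in_add_at.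
      * eauto using covers_add_at, covers_below.
    + refine (K (add_at true (w, A2) t) (ext_add_at _ _ _) _ f v _).
      * right. apply in_add_at.
      * eauto using covers_add_at, covers_below.
  - apply (step_ImpR c). intros v bl c1 c2.
    refine (K (add_at true (w, A1) (add_at false (w, A2) t)) _ _ f v _).
    + eauto using ext_trans, ext_add_at.
    + split; auto using in_add_at, in_add_at_l.
    + eauto using covers_add_at, covers_below.
  - apply (step_EmpL c). intros v bl g.
    refine (K (add_rel (eps, w, eps) t) (ext_add_rel _ _) _ f v _).
    + now left.
    + pose proof (proj1 C) as E.
      apply covers_add_rel; [eauto using covers_below | now rewrite E].
  - apply (step_StarL c). intros v x y bl g c1 c2.
    destruct (nm v x y bl) as (C' & ex & ey & ew).
    refine (K (add_at true (lvar n, A1) (add_at true (lvar (S n), A2)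
                (add_rel (lvar n, lvar (S n), w) t))) _ _ _ v _).
    + eauto using ext_trans, ext_add_at, ext_add_rel.
    + exists (lvar n), (lvar (S n)).
      split; [now left|]. auto using in_add_at, in_add_at_l.
    + apply covers_add_at; [apply covers_add_at; [apply covers_add_rel; [exact C'|]|]|];
        now rewrite ?ex, ?ey, ?ew.
  - apply (step_WandR c). intros v x y bl g c1 c2.
    destruct (nm v x y bl) as (C' & ex & ey & ew).
    refine (K (add_at true (lvar n, A1) (add_at false (lvar (S n), A2)
                (add_rel (lvar n, w, lvar (S n)) t))) _ _ _ v _).
    + eauto using ext_trans, ext_add_at, ext_add_rel.
    + exists (lvar n), (lvar (S n)).
      split; [now left|]. auto using in_add_at, in_add_at_l.
    + apply covers_add_at; [apply covers_add_at; [apply covers_add_rel; [exact C'|]|]|];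
        now rewrite ?ex, ?ey, ?ew.
Qed.

(* The part of saturation that concerns the formulae kept by their rules. *)
Definition demand_at (b : bool) A (w : label) (r : ratom) t : Prop :=
  let '(x, y, z) := r in
  match A with
  | Star A B => if b then True
                else z = w -> In (x, A) (side t false) \/ In (y, B) (side t false)
  | Wand A B => if b
                then y = w -> In (x, A) (side t false) \/ In (z, B) (side t true)
                else True
  | _ => True
  end.

Lemma forceable_demand_at s b A w r : In (w, A) (side s b) -> In r (rel s) ->
  forceable s (demand_at b A w r).
Proof.
  intros i g. destruct r as [[x y] z].
  destruct A as [| | | | | |A B|A B], b; try apply forceable_True; simpl;
    apply forceable_imp; intros E; subst w.
  - apply forceable_intro.
    { intros t u [_ l] [k | k]; [left | right]; now apply l. }
    intros t e K f u C. apply e in i. apply e in g. apply C in g.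
    apply (step_StarR _ _ (covers_in _ _ _ C i) g). intros v bl [c | c].
    + refine (K (add_at false (x, A) t) (ext_add_at _ _ _) _ f v _).
      * left. apply in_add_at.
      * eauto using covers_add_at, covers_below.
    + refine (K (add_at false (y, B) t) (ext_add_at _ _ _) _ f v _).
      * right. apply in_add_at.
      * eauto using covers_add_at, covers_below.
  - apply forceable_intro.
    { intros t u [_ l] [k | k]; [left | right]; now apply l. }
    intros t e K f u C. apply e in i. apply e in g. apply C in g.
    apply (step_WandL _ _ (covers_in _ _ _ C i) g). intros v bl [c | c].
    + refine (K (add_at false (x, A) t) (ext_add_at _ _ _) _ f v _).
      * left. apply in_add_at.
      * eauto using covers_add_at, covers_below.
    + refine (K (add_at true (z, B) t) (ext_add_at _ _ _) _ f v _).
      * right. apply in_add_at.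
      * eauto using covers_add_at, covers_below.
Qed.

Lemma forceable_rel s r :
  (forall t, ext s t -> (robust (add_rel r t) -> robust t)) ->
  forceable s (fun t => In r (rel t)).
Proof.
  intros k. apply forceable_intro.
  - intros t u e i. now apply e.
  - intros t e K. apply k; trivial. apply K; [apply ext_add_rel | now left].
Qed.

Lemma forceable_U s a : forceable s (fun t => In (a, eps, a) (rel t)).
Proof.
  apply forceable_rel. intros t e K f u C.
  apply (step_U (f a)). intros v bl i. apply (K f).
  pose proof (proj1 C) as E.
  apply covers_add_rel; [eauto using covers_below | now rewrite E].
Qed.

(** Turns a substitution rule into the addition of an equation: once a refinement [g] identifies [a]
    and [b], the image of (eps, a |> b) is (eps, g a |> g a), which U followed by E provides. *)
Lemma robust_equal s a b :
  (forall f u, covers f s u ->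
     (forall g v, covers g s v -> g a = g b -> provable v) -> provable u) ->
  robust (add_rel (eps, a, b) s) -> robust s.
Proof.
  intros k K f u C. apply (k f u C). intros g v C' E.
  apply (step_U (g a)). intros v' bl i.
  apply (step_E _ _ _ i). intros v'' bl' i'. apply (K g).
  apply covers_add_rel; [eauto using covers_below|].
  now rewrite (proj1 C'), <- E.
Qed.

(** Closure conditions for a pair of atoms: commutativity, associativity, partial determinism,
    cancellativity, indivisible unit, and congruence of the equations (eps, a |> b) in the first and
    in the third place. Congruence in the second place follows by commutativity. *)
Definition demand_rel (r r' : ratom) t : Prop :=
  let '(x, y, z) := r in
  let '(u, v, w) := r' in
  In (y, x, z) (rel t) /\
  (w = x -> exists a, In (u, a, z) (rel t) /\ In (y, v, a) (rel t)) /\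
  (x = u /\ y = v -> In (eps, z, w) (rel t)) /\
  (x = u /\ z = w -> In (eps, y, v) (rel t)) /\
  (z = eps -> In (eps, x, eps) (rel t)) /\
  (x = eps /\ y = u -> In (z, v, w) (rel t)) /\
  (x = eps /\ y = w -> In (u, v, z) (rel t)).

Lemma forceable_demand_rel s r r' : In r (rel s) -> In r' (rel s) ->
  forceable s (demand_rel r r').
Proof.
  destruct r as [[x y] z], r' as [[u v] w]. intros g g'. simpl.
  repeat apply forceable_and; try apply forceable_imp; try intros E.
  - apply forceable_rel. intros t e K f t' C. apply e in g. apply C in g.
    apply (step_E _ _ _ g). intros v' bl i. apply (K f).
    apply covers_add_rel; [eauto using covers_below | trivial].
  - subst w. apply forceable_intro.
    { intros t t' [l _] (a & k1 & k2). exists a. split; now apply l. }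
    intros t e K f t' C. apply e in g, g'.
    destruct (labs_rel _ _ _ _ g) as (ix & iy & iz).
    destruct (labs_rel _ _ _ _ g') as (iu & iv & _).
    apply C in g, g'. apply (step_A _ _ _ _ _ g g'). intros t'' a bl k1 k2.
    (* The extension of [t] gets its own intermediate label [n], which is mapped to the label [a]
       produced by rule A in the refinement. *)
    destruct (exists_fresh_above (labs t)) as [n fr].
    pose proof (fr n (le_n n)) as fr0.
    refine (K (add_rel (u, lvar n, z) (add_rel (y, v, lvar n) t)) _ _
              (upd f n a) t'' _).
    + eauto using ext_trans, ext_add_rel.
    + exists (lvar n). split; simpl; auto.
    + assert (nm : forall b, In b (labs t) -> upd f n a b = f b).
      { intros b ib. apply upd_other. now intros ->. }
      apply covers_add_rel; [apply covers_add_rel|].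
      * apply covers_upd, fr0. eauto using covers_below.
      * now rewrite upd_same, !nm.
      * now rewrite upd_same, !nm.
  - destruct E as [<- <-]. apply forceable_rel. intros t e. apply robust_equal.
    intros f t' C. apply e in g, g'. apply C in g, g'. intros k.
    apply (step_P _ _ g g'). intros h t'' C' E.
    apply (k _ _ (covers_trans C C') E).
  - destruct E as [<- <-]. apply forceable_rel. intros t e. apply robust_equal.
    intros f t' C. apply e in g, g'. apply C in g, g'. intros k.
    apply (step_C _ _ g g'). intros h t'' C' E.
    apply (k _ _ (covers_trans C C') E).
  - subst z. apply forceable_rel. intros t e. apply robust_equal.
    intros f t' C. apply e in g. apply C in g. rewrite (proj1 C) in g. intros k.
    apply (step_IU _ g). intros h t'' C' E.
    apply (k _ _ (covers_trans C C')). now rewrite E, (proj1 C), (proj1 C').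
  (* Once the refinement has identified the two sides of the equation, the atom to be added has the
     same image as one already in [t]. *)
  - destruct E as [-> <-]. apply forceable_rel. intros t e K f t' C.
    apply e in g, g'. apply C in g. rewrite (proj1 C) in g.
    apply (step_Eq g). intros h t'' C' E.
    pose proof (covers_trans C C') as C''. refine (K _ _ (covers_add_rel _ _ _ C'' _)). rewrite <- E.
    now apply (proj1 (proj2 C'') y v w).
  - destruct E as [-> <-]. apply forceable_rel. intros t e K f t' C.
    apply e in g, g'. apply C in g. rewrite (proj1 C) in g.
    apply (step_Eq g). intros h t'' C' E.
    pose proof (covers_trans C C') as C''. refine (K _ _ (covers_add_rel _ _ _ C'' _)).
    rewrite <- E. now apply (proj1 (proj2 C'') u v y).
Qed.

(** Equations are not substituted away in [s], so its axioms have to be recognised modulo them; the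
    refinement is closed by Eq1 or Eq2 followed by the ordinary axiom. *)
Lemma robust_id s a b p : In (eps, a, b) (rel s) ->
  In (a, Atom p) (side s true) -> In (b, Atom p) (side s false) -> robust s.
Proof.
  intros g i j f t C. apply C in g. rewrite (proj1 C) in g.
  apply (step_Eq g). intros h u C' E.
  pose proof (covers_trans C C') as C''. apply (@provable_id Var u (h (f a)) p).
  - exact (covers_in _ _ _ C'' i).
  - rewrite E. exact (covers_in _ _ _ C'' j).
Qed.

Lemma robust_EmpR s a : In (eps, a, eps) (rel s) ->
  In (a, Emp) (side s false) -> robust s.
Proof.
  intros g i f t C. apply C in g. rewrite (proj1 C) in g.
  apply (step_Eq g). intros h u C' E.
  pose proof (covers_trans C C') as C''. apply (@provable_EmpR Var u).
  rewrite <- (proj1 C'), <- E. exact (covers_in _ _ _ C'' i).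
Qed.

Lemma robust_BotL s a : In (a, Bot) (side s true) -> robust s.
Proof. intros i f t C. exact (provable_BotL (covers_in _ _ _ C i)). Qed.

Lemma robust_TopR s a : In (a, Top) (side s false) -> robust s.
Proof. intros i f t C. exact (provable_TopR (covers_in _ _ _ C i)). Qed.

(** Only finitely many requirements per round. The bound [n] grows with the stage, so that in the
    limit U has been applied to every label, whether or not it occurs in the sequent. *)
Definition round n s t : Prop :=
  (forall b wA, In wA (side s b) -> demand b (snd wA) (fst wA) t) /\
  (forall b wA, In wA (side s b) -> forall r, In r (rel s) ->
     demand_at b (snd wA) (fst wA) r t) /\
  (forall r, In r (rel s) -> forall r', In r' (rel s) -> demand_rel r r' t) /\
  (forall a, In a (eps :: map lvar (seq 0 n)) -> In (a, eps, a) (rel t)).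

Lemma forceable_bool s (Q : bool -> sequent Var -> Prop) :
  (forall b, forceable s (Q b)) -> forceable s (fun t => forall b, Q b t).
Proof.
  intros k. destruct (forceable_and (k true) (k false)) as [p q]. split.
  - intros t u e a b. exact (proj1 (k b) t u e (a b)).
  - intros t e n. destruct (q t e n) as (u & e' & n' & a & a').
    exists u. repeat (split; [assumption|]). now intros [].
Qed.

Lemma forceable_round n s : forceable s (round n s).
Proof.
  repeat apply forceable_and.
  - apply forceable_bool. intros b. apply forceable_list. intros [w A] i.
    now apply forceable_demand.
  - apply forceable_bool. intros b. apply forceable_list. intros [w A] i.
    apply forceable_list. intros r g. now apply forceable_demand_at.
  - apply forceable_list. intros r g. apply forceable_list. intros r' g'.
    now apply forceable_demand_rel.
  - apply forceable_list. intros a _. apply forceable_U.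
Qed.

(** The choice by [epsilon] is meaningful only while the previous stage is not robust; [chain_step]
    shows that this persists. *)
Fixpoint chain s n : sequent Var :=
  match n with
  | 0 => s
  | S n => epsilon (inhabits s)
             (fun t => ext (chain s n) t /\ ~ robust t /\ round n (chain s n) t)
  end.

(** * The limit of the saturation rounds *)

Section Chain.
Variable s : sequent Var.
Hypothesis ns : ~ robust s.

Lemma chain_step n : ~ robust (chain s n) /\
  ext (chain s n) (chain s (S n)) /\ round n (chain s n) (chain s (S n)).
Proof.
  assert (k : forall m, ~ robust (chain s m) ->
    ext (chain s m) (chain s (S m)) /\ ~ robust (chain s (S m)) /\
    round m (chain s m) (chain s (S m))).
  { intros m nr. simpl. apply epsilon_spec.
    apply (proj2 (forceable_round m (chain s m))); auto using ext_refl. }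
  assert (nr : forall m, ~ robust (chain s m)).
  { induction m; [exact ns | now apply k]. }
  split; [apply nr|]. split; apply (k n (nr n)).
Qed.

Lemma chain_le m n : m <= n -> ext (chain s m) (chain s n).
Proof.
  induction 1; [apply ext_refl|].
  eapply ext_trans; [eassumption|]. apply chain_step.
Qed.

Definition lim_rel a b c := exists n, In (a, b, c) (rel (chain s n)).
Definition lim_side b w A := exists n, In (w, A) (side (chain s n) b).

Lemma lim_rel_demand x y z u v w : lim_rel x y z -> lim_rel u v w ->
  exists n, demand_rel (x, y, z) (u, v, w) (chain s n).
Proof.
  (* Both atoms are present at stage [m + n], and the next round treats the pair. *)
  intros [m i] [n j]. exists (S (m + n)).
  destruct (chain_step (m + n)) as (_ & _ & _ & _ & k & _).
  apply k; eapply chain_le; try eassumption; lia.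
Qed.

Lemma lim_side_demand b w A : lim_side b w A ->
  exists n, demand b A w (chain s n).
Proof.
  intros [n i]. exists (S n).
  destruct (chain_step n) as (_ & _ & k & _). exact (k b (w, A) i).
Qed.

Lemma lim_side_demand_at b w A x y z : lim_side b w A -> lim_rel x y z ->
  exists n, demand_at b A w (x, y, z) (chain s n).
Proof.
  intros [m i] [n j]. exists (S (m + n)).
  destruct (chain_step (m + n)) as (_ & _ & _ & k & _).
  apply (k b (w, A)); eapply chain_le; try eassumption; lia.
Qed.

Lemma lim_U a : lim_rel a eps a.
Proof.
  assert (e : exists n, In a (eps :: map lvar (seq 0 n))).
  (* The bound must be [S x], as [seq 0 n] stops before [n]. *)
  { destruct a as [|x]; [exists 0; now left|]. exists (S x). right.
    apply in_map, in_seq. lia. }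
  destruct e as [n i]. exists (S n).
  destruct (chain_step n) as (_ & _ & _ & _ & _ & k). auto.
Qed.
End Chain.

End Saturation.
(** * The canonical model *)

Section Canonical.
Variables (Var : Type) (G : label -> label -> label -> Prop)
  (F : bool -> label -> formula Var -> Prop).

Hypothesis G_unit : forall a, G a eps a.
Hypothesis G_comm : forall a b c, G a b c -> G b a c.
Hypothesis G_assoc : forall x y z u v, G x y z -> G u v x ->
  exists w, G u w z /\ G y v w.
Hypothesis G_pdet : forall x y z w, G x y z -> G x y w -> G eps z w.
Hypothesis G_cancel : forall x y z w, G x y z -> G x w z -> G eps y w.
Hypothesis G_indiv : forall x y, G x y eps -> G eps x eps.
Hypothesis G_eq1 : forall a b y z, G eps a b -> G a y z -> G b y z.
Hypothesis G_eq3 : forall a b x y, G eps a b -> G x y a -> G x y b.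

Lemma eqv_refl a : G eps a a.
Proof. apply G_comm, G_unit. Qed.

(** Symmetry comes from partial determinism: (eps, a |> b) and (eps, a |> a) share their first two
    labels. *)
Lemma eqv_sym a b : G eps a b -> G eps b a.
Proof. intros e. apply (G_pdet e), eqv_refl. Qed.

Lemma eqv_congr a b c a' b' c' : G eps a a' -> G eps b b' -> G eps c c' ->
  G a b c -> G a' b' c'.
Proof.
  intros e1 e2 e3 g. apply (G_eq3 e3), (G_eq1 e1), G_comm.
  apply (G_eq1 e2). now apply G_comm.
Qed.

(** A quotient by canonical representatives: the choice is made from the whole class, and equivalent
    labels define extensionally equal predicates, so they receive the same choice. Worlds are then
    the fixed points of [rep]. *)
Definition rep (a : label) : label := epsilon (inhabits eps) (fun b => G eps a b).

Lemma eqv_rep a : G eps a (rep a).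
Proof. apply (epsilon_spec (inhabits eps) (fun b => G eps a b)). exists a. apply eqv_refl. Qed.

Lemma rep_eq a b : G eps a b -> rep a = rep b.
Proof.
  intros e. unfold rep. f_equal. extensionality c. apply propositional_extensionality.
  split; intros k; [apply (G_eq3 k), eqv_sym | apply (G_eq3 k)]; trivial.
Qed.

Definition cworld : Type := {a | rep a = a}.

Definition cls (a : label) : cworld :=
  exist _ (rep a) (eq_sym (rep_eq (eqv_rep a))).

Definition lab (h : cworld) : label := proj1_sig h.

Lemma lab_inj (h k : cworld) : G eps (lab h) (lab k) -> h = k.
Proof.
  destruct h as [a p], k as [b q]. simpl. intros e. apply rep_eq in e.
  assert (E : a = b) by congruence. subst b. f_equal. apply proof_irrelevance.
Qed.

Lemma cls_lab h : cls (lab h) = h.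
Proof. apply lab_inj. apply eqv_sym, eqv_rep. Qed.

Lemma G_cls a b c : G (lab (cls a)) (lab (cls b)) (lab (cls c)) <-> G a b c.
Proof. split; apply eqv_congr; auto using eqv_rep, eqv_sym. Qed.

Definition cR (h k l : cworld) : Prop := G (lab h) (lab k) (lab l).

Lemma cR_unit h k : cR h (cls eps) k <-> h = k.
Proof.
  unfold cR. split.
  - intros g. apply lab_inj. apply G_comm. revert g.
    apply eqv_congr; auto using eqv_refl, eqv_sym, eqv_rep.
  - intros <-. generalize (G_unit (lab h)).
    apply eqv_congr; auto using eqv_refl, eqv_rep.
Qed.

Lemma cR_comm h k l : cR h k l <-> cR k h l.
Proof. split; apply G_comm. Qed.

Lemma cR_assoc h1 h2 h3 h4 h5 : cR h1 h5 h4 /\ cR h2 h3 h5 ->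
  exists h6, cR h6 h3 h4 /\ cR h1 h2 h6.
Proof.
  intros [g1 g2]. apply G_comm in g1, g2.
  destruct (G_assoc g1 g2) as (w & k1 & k2).
  exists (cls w). unfold cR. split.
  - apply G_comm. revert k1. apply eqv_congr; auto using eqv_refl, eqv_rep.
  - revert k2. apply eqv_congr; auto using eqv_refl, eqv_rep.
Qed.

Lemma cR_cancel h1 h2 h3 h4 : cR h1 h2 h3 /\ cR h1 h4 h3 -> h2 = h4.
Proof. intros [g1 g2]. apply lab_inj. exact (G_cancel g1 g2). Qed.

Lemma cR_pdet h1 h2 h3 h4 : cR h1 h2 h3 /\ cR h1 h2 h4 -> h3 = h4.
Proof. intros [g1 g2]. apply lab_inj. exact (G_pdet g1 g2). Qed.

Definition cframe : frame :=
  Frame cR (cls eps) cR_unit cR_comm cR_assoc cR_cancel cR_pdet.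

Lemma cframe_indivisible : indivisible_unit cframe.
Proof.
  intros h k g. apply lab_inj. simpl in *.
  assert (g' : G eps (lab h) eps).
  { apply (G_indiv (y := lab k)). revert g.
    apply eqv_congr; auto using eqv_refl, eqv_sym, eqv_rep. }
  revert g'. apply eqv_congr; auto using eqv_refl, eqv_rep.
Qed.

Hypothesis F_id : forall a b p, G eps a b ->
  F true a (Atom p) -> F false b (Atom p) -> False.
Hypothesis F_Bot : forall a, ~ F true a Bot.
Hypothesis F_Top : forall a, ~ F false a Top.
Hypothesis F_AndL : forall a A B, F true a (And A B) -> F true a A /\ F true a B.
Hypothesis F_AndR : forall a A B, F false a (And A B) -> F false a A \/ F false a B.
Hypothesis F_ImpL : forall a A B, F true a (Imp A B) -> F false a A \/ F true a B.
Hypothesis F_ImpR : forall a A B, F false a (Imp A B) -> F true a A /\ F false a B.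
Hypothesis F_EmpL : forall a, F true a Emp -> G eps a eps.
Hypothesis F_EmpR : forall a, F false a Emp -> ~ G eps a eps.
Hypothesis F_StarL : forall a A B, F true a (Star A B) ->
  exists x y, G x y a /\ F true x A /\ F true y B.
Hypothesis F_StarR : forall a A B x y, F false a (Star A B) -> G x y a ->
  F false x A \/ F false y B.
Hypothesis F_WandL : forall a A B x y, F true a (Wand A B) -> G x a y ->
  F false x A \/ F true y B.
Hypothesis F_WandR : forall a A B, F false a (Wand A B) ->
  exists x y, G x a y /\ F true x A /\ F false y B.

(** Saturation does not copy formulae along equations, so any member of the class may carry the
    atom; [F_id] is stated modulo equations to match. *)
Definition cval (p : Var) (h : cframe) : Prop :=
  exists a, G eps a (lab h) /\ F true a (Atom p).

Lemma truth A : forall a,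
  (F true a A -> forces cframe cval (cls a) A) /\
  (F false a A -> ~ forces cframe cval (cls a) A).
Proof.
  induction A as [p| | |A IHA B IHB|A IHA B IHB| |A IHA B IHB|A IHA B IHB];
    intros a; split; intros i; simpl.
  - exists a. split; [apply eqv_rep | exact i].
  - intros (b & e & j). apply (F_id (a := b) (b := a) (p := p)); trivial.
    revert e. apply eqv_congr; auto using eqv_refl, eqv_sym, eqv_rep.
  - exact I.
  - now apply F_Top in i.
  - now apply F_Bot in i.
  - tauto.
  - apply F_AndL in i. destruct i. split; [now apply IHA | now apply IHB].
  - intros [j k]. apply F_AndR in i. destruct i as [i | i].
    + now apply (proj2 (IHA a)).
    + now apply (proj2 (IHB a)).
  - intros j. apply F_ImpL in i. destruct i as [i | i].
    + now apply (proj2 (IHA a)) in i.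
    + now apply IHB.
  - intros j. apply F_ImpR in i. destruct i as [i k].
    apply (proj2 (IHB a) k), j. now apply IHA.
  - apply lab_inj. apply F_EmpL in i. revert i.
    apply eqv_congr; auto using eqv_refl, eqv_rep.
  - intros e. apply (F_EmpR i). apply G_cls. rewrite e. apply G_cls, G_unit.
  - apply F_StarL in i. destruct i as (x & y & g & j & k).
    exists (cls x), (cls y). split; [|split; [now apply IHA | now apply IHB]].
    now apply G_cls.
  (* The worlds are rewritten as classes of their own labels to fit the induction hypotheses, and
     congruence moves the atom from the representative of [a] to [a] itself, the label carrying the
     formula. *)
  - intros (h & k & g & j1 & j2). rewrite <- (cls_lab h) in j1. rewrite <- (cls_lab k) in j2.
    assert (g' : G (lab h) (lab k) a).
    { revert g. apply eqv_congr; auto using eqv_refl, eqv_sym, eqv_rep. }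
    destruct (F_StarR i g') as [l | l].
    + now apply IHA in l.
    + now apply IHB in l.
  - intros h k g j. rewrite <- (cls_lab h) in j. rewrite <- (cls_lab k).
    assert (g' : G (lab h) a (lab k)).
    { apply G_comm. revert g. apply eqv_congr; auto using eqv_refl, eqv_sym, eqv_rep. }
    destruct (F_WandL i g') as [l | l].
    + now apply IHA in l.
    + now apply IHB.
  - intros j. apply F_WandR in i. destruct i as (x & y & g & k & l).
    apply (proj2 (IHB y) l). apply (j (cls x)); [|now apply IHA].
    now apply G_cls, G_comm.
Qed.
End Canonical.

(** * Countermodels, cut-free completeness and cut admissibility *)

Theorem countermodel (Var : Type) (s : sequent Var) : ~ robust s ->
  exists (H : frame) (nu : Var -> H -> Prop) (rho : label -> H),
    indivisible_unit H /\ refutes H nu rho (rel s) (side s true) (side s false).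
Proof.
  intros ns.
  set (G := lim_rel s). set (F := lim_side s).
  assert (G_unit : forall a, G a eps a) by (intros a; apply (lim_U ns)).
  assert (G_comm : forall a b c, G a b c -> G b a c).
  { intros a b c g. destruct (lim_rel_demand ns g g) as [n k]. exists n. apply k. }
  assert (G_assoc : forall x y z u v, G x y z -> G u v x ->
            exists w, G u w z /\ G y v w).
  { intros x y z u v g g'. destruct (lim_rel_demand ns g g') as [n k].
    destruct (proj1 (proj2 k) eq_refl) as (w & k1 & k2).
    exists w. split; now exists n. }
  assert (G_pdet : forall x y z w, G x y z -> G x y w -> G eps z w).
  { intros x y z w g g'. destruct (lim_rel_demand ns g g') as [n k].
    exists n. now apply k. }
  assert (G_cancel : forall x y z w, G x y z -> G x w z -> G eps y w).
  { intros x y z w g g'. destruct (lim_rel_demand ns g g') as [n k].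
    exists n. now apply k. }
  assert (G_indiv : forall x y, G x y eps -> G eps x eps).
  { intros x y g. destruct (lim_rel_demand ns g g) as [n k].
    exists n. now apply k. }
  assert (G_eq1 : forall a b y z, G eps a b -> G a y z -> G b y z).
  { intros a b y z g g'. destruct (lim_rel_demand ns g g') as [n k].
    exists n. now apply k. }
  assert (G_eq3 : forall a b x y, G eps a b -> G x y a -> G x y b).
  { intros a b x y g g'. destruct (lim_rel_demand ns g g') as [n k].
    exists n. now apply k. }
  pose (H := cframe G G_unit G_comm G_assoc G_pdet G_cancel G_eq1 G_eq3).
  pose (rho := cls G G_unit G_comm G_pdet G_eq3).
  pose (nu := @cval Var G F G_unit G_comm G_assoc G_pdet G_cancel G_eq1 G_eq3).
  assert (T : forall A a,
    (F true a A -> forces H nu (rho a) A) /\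
    (F false a A -> ~ forces H nu (rho a) A)).
  { apply truth.
    - intros a b p [n1 g] [n2 i] [n3 j].
      (* A clash in the limit already occurs at a common finite stage, which would then be
         robust. *)
      apply (proj1 (chain_step ns (n1 + n2 + n3))).
      apply robust_id with (a := a) (b := b) (p := p); eapply chain_le; try eassumption; lia.
    - intros a [n i]. apply (proj1 (chain_step ns n)), (robust_BotL _ i).
    - intros a [n i]. apply (proj1 (chain_step ns n)), (robust_TopR _ i).
    - intros a A B i. destruct (lim_side_demand ns i) as [n [k1 k2]].
      split; now exists n.
    - intros a A B i. destruct (lim_side_demand ns i) as [n [k | k]];
        [left | right]; now exists n.
    - intros a A B i. destruct (lim_side_demand ns i) as [n [k | k]];
        [left | right]; now exists n.
    - intros a A B i. destruct (lim_side_demand ns i) as [n [k1 k2]].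
      split; now exists n.
    - intros a i. destruct (lim_side_demand ns i) as [n k]. now exists n.
    - intros a [n1 i] [n2 g]. apply (proj1 (chain_step ns (n1 + n2))).
      apply robust_EmpR with (a := a); eapply chain_le; try eassumption; lia.
    - intros a A B i. destruct (lim_side_demand ns i) as [n (x & y & k1 & k2 & k3)].
      exists x, y. split; [|split]; now exists n.
    - intros a A B x y i g. destruct (lim_side_demand_at ns i g) as [n k].
      destruct (k eq_refl); [left | right]; now exists n.
    - intros a A B x y i g. destruct (lim_side_demand_at ns i g) as [n k].
      destruct (k eq_refl); [left | right]; now exists n.
    - intros a A B i. destruct (lim_side_demand ns i) as [n (x & y & k1 & k2 & k3)].
      exists x, y. split; [|split]; now exists n. }
  exists H, nu, rho. split; [|split; [|split; [|split]]].
  - apply cframe_indivisible. exact G_indiv.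
  - reflexivity.
  - intros a b c i. apply (proj2 (@G_cls G G_unit G_comm G_pdet G_eq1 G_eq3 a b c)).
    (* Stage 0 of the chain is [s], so the limit model refutes [s] itself. *)
    now exists 0.
  - intros w A i. apply T. now exists 0.
  - intros w A i. apply T. now exists 0.
Qed.

Theorem completeness (Var : Type) G (Gam Del : list (lformula Var)) :
  (forall (H : frame) (nu : Var -> H -> Prop) (rho : label -> H),
     indivisible_unit H -> ~ refutes H nu rho G Gam Del) ->
  derivable false G Gam Del.
Proof.
  intros v. pose (s := Seq G (fun b : bool => if b then Gam else Del)).
  assert (r : robust s).
  { apply NNPP. intros n. destruct (countermodel n) as (H & nu & rho & i & r).
    exact (v H nu rho i r). }
  exact (r _ _ (covers_id s)).
Qed.

Unset Implicit Arguments.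

Theorem mainTheorem8 (Var : Type) :
  (forall F : formula Var,
     (exists w : nat, derivable true [] [] [(lvar w, F)]) ->
     valid_over indivisible_unit F) /\
  (forall F : formula Var,
     valid_over indivisible_unit F ->
     exists w : nat, derivable false [] [] [(lvar w, F)]) /\
  (forall (G G' : list ratom) (Gam Gam' Del Del' : list (lformula Var))
      (x : label) (A : formula Var),
     derivable false G Gam ((x, A) :: Del) ->
     derivable false G' ((x, A) :: Gam') Del' ->
     derivable false (G ++ G') (Gam ++ Gam') (Del ++ Del')).
Proof.
  split; [|split].
  - intros F [w d] H iu nu h. apply NNPP. intros n.
    apply (soundness iu d (rho := upd (fun _ => emp H) w h) (nu := nu)).
    split; [reflexivity|]. split; [intros ? ? ? []|]. split; [intros ? ? []|].
    intros v A [E | []]. injection E as <- <-. now rewrite upd_same.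
  - intros F v. exists 0. apply completeness. intros H nu rho iu (_ & _ & _ & r).
    apply (r (lvar 0) F); [now left|]. now apply v.
  - intros G G' Gam Gam' Del Del' x A d d'. apply completeness.
    (* The cut formula is either true or false at the world of [x], so a refutation of the
       conclusion refutes one of the two premises. *)
    intros H nu rho iu ref. destruct (classic (forces H nu (rho x) A)) as [f | f].
    + apply (soundness iu d' (nu := nu) (rho := rho)). rewrite refutes_ant.
      split; trivial. revert ref. apply refutes_incl; auto using incl_appr, incl_refl.
    + apply (soundness iu d (nu := nu) (rho := rho)). rewrite refutes_suc.
      split; trivial. revert ref. apply refutes_incl; auto using incl_appl, incl_refl.
Qed.
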